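(* For online (uniform-cost) Facility Location in the $p$-sample independent model, the following algorithm is monotone and $O(\log(1/p))$-competitive with respect to the offline optimum $\mathrm{OPT}(V)$: Phase 1: receive the sample set $S$, run any offline $O(1)$-approximation algorithm for facility location on clients $S$, and open its facilities $\hat F$. Phase 2: with $F_0=\hat F$, for each real arrival $x_i\in R$ (in order), open a new facility at $x_i$ with probability $\min\{d(x_i,F_{i-1})/f,1\}$, let $F_i$ be the resulting set of open facilities, and connect $x_i$ to its closest facility in $F_i$.
   Context: Facility Location (uniform cost): demands (clients) are points of a metric space with distance $d$; opening a facility costs $f$; for a set $F$ of open facilities, $d(x,F)=\min_{c\in F}d(c,x)$. The cost of a solution is $f$ times the number of open facilities plus the sum over served clients of their connection distances. $\mathrm{OPT}(V)$ is the optimal offline cost of serving all clients in $V$. $p$-sample independent model: an adversary chooses an unknown value set $V=\{v_1,\dots,v_n\}$ of clients; a sample $S\subseteq V$, containing each $v_i$ independently with probability $p$, is revealed upfront; the real values $R=V\setminus S$ arrive in adversarial order and must be served online. An algorithm is $\alpha(p)$-competitive if its expected total cost is at most $\alpha(p)\cdot\mathrm{OPT}(V)$. It is monotone if it remains $\alpha(p)$-competitive when the sample set is augmented by moving some (possibly adversarially chosen) real values into it, i.e. the sample is any $S\supseteq S'$ where $S'$ contains each $v_i$ independently with probability $p$, and the demand set is $V\setminus S$. *)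

(* Defs.v *)
From HB Require Import structures.
From mathcomp Require Import all_boot all_order all_algebra.
From mathcomp Require Import all_classical all_reals exp.
Set Implicit Arguments. Unset Strict Implicit. Unset Printing Implicit Defensive.
Import Order.TTheory GRing.Theory Num.Theory.
Local Open Scope ring_scope.
Local Open Scope classical_set_scope.

Section FL.
Variables (R : realType) (T : Type) (d : T -> T -> R) (f : R).

Definition is_metric : Prop :=
  (forall x y, 0 <= d x y) /\ (forall x y, d x y = 0 <-> x = y) /\
  (forall x y, d x y = d y x) /\ (forall x y z, d x z <= d x y + d y z).

(* d(x,F) = min_{c in F} d(c,x) for a nonempty facility list F
   (the value for the empty list is irrelevant, see [feasible]) *)
Definition dist (x : T) (F : seq T) : R :=
  match F with
  | [::] => 0
  | c :: F' => foldr (fun c' m => Num.min (d c' x) m) (d c x) F'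
  end.

Definition fl_cost (F W : seq T) : R :=
  f * (size F)%:R + \sum_(x <- W) dist x F.

Definition feasible (F W : seq T) : bool :=
  (size W == 0)%N || (0 < size F)%N.

Definition OPT (W : seq T) : R :=
  inf [set c | exists F : seq T, feasible F W /\ c = fl_cost F W].

Definition approx_alg (gamma : R) (A : seq T -> seq T) : Prop :=
  forall W : seq T, feasible (A W) W /\ fl_cost (A W) W <= gamma * OPT W.

(* probability of opening a facility at x given current facilities F:
   min(d(x,F)/f, 1), with d(x, emptyset) = +oo *)
Definition open_prob (x : T) (F : seq T) : R :=
  if F is [::] then 1 else Num.min (dist x F / f) 1.

(* Phase 2: expected cost (over the algorithm's coins) of serving the
   arrival sequence xs in order, starting with open facilities F.
   If a facility is opened at x it costs f and x connects to it at
   distance d x x = 0; otherwise x connects to its closest facility. *)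
Fixpoint phase2_cost (F : seq T) (xs : seq T) : R :=
  match xs with
  | [::] => 0
  | x :: xs' =>
      open_prob x F * (f + phase2_cost (x :: F) xs')
      + (1 - open_prob x F) * (dist x F + phase2_cost F xs')
  end.

Definition alg_cost (A : seq T -> seq T) (Ssmp arr : seq T) : R :=
  f * (size (A Ssmp))%:R + phase2_cost (A Ssmp) arr.

(* Expected cost in the p-sample model, where the random sample S' contains
   each index independently with probability p, the actual sample is
   aug S' (aug S' contains S'), and the real values V \ aug S' arrive in the
   adversarial order ord (aug S'). *)
Definition exp_cost (A : seq T -> seq T) (p : R) (n : nat) (v : 'I_n -> T)
    (aug : {set 'I_n} -> {set 'I_n}) (ord : {set 'I_n} -> seq 'I_n) : R :=
  \sum_(S' : {set 'I_n})
     p ^+ #|S'| * (1 - p) ^+ (n - #|S'|) *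
     alg_cost A [seq v i | i <- enum (aug S')] [seq v i | i <- ord (aug S')].

Definition valid_order n (ord : {set 'I_n} -> seq 'I_n) : Prop :=
  forall S : {set 'I_n}, perm_eq (ord S) (enum (~: S)).

Definition competitive (A : seq T -> seq T) (p alpha : R) : Prop :=
  forall (n : nat) (v : 'I_n -> T) (ord : {set 'I_n} -> seq 'I_n),
    valid_order ord ->
    exp_cost A p v id ord <= alpha * OPT [seq v i | i <- enum 'I_n].

(* monotone: still alpha-competitive when the sample is augmented by
   (adversarially chosen) real values *)
Definition monotone_competitive (A : seq T -> seq T) (p alpha : R) : Prop :=
  forall (n : nat) (v : 'I_n -> T) (aug : {set 'I_n} -> {set 'I_n})
         (ord : {set 'I_n} -> seq 'I_n),
    (forall S' : {set 'I_n}, S' \subset aug S') ->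
    valid_order ord ->
    exp_cost A p v aug ord <= alpha * OPT [seq v i | i <- enum 'I_n].

End FL.

(* Main.v *)
Require Import Defs.
From HB Require Import structures.
From mathcomp Require Import all_boot all_order all_algebra.
From mathcomp Require Import all_classical all_reals exp.
From mathcomp Require Import ring lra.
Set Implicit Arguments. Unset Strict Implicit. Unset Printing Implicit Defensive.
Import Order.TTheory GRing.Theory Num.Theory.
Local Open Scope ring_scope.

(** Fix any solution [G] and assign each client to its nearest facility of [G].
    For a cluster with center [c] and [m] clients at distances [r_i] from [c],
    let [X = f + sum r_i + sum_(sampled i) d(v_i, Fhat)], [L = X / (m + 1)] and
    track the potential [(2 f / ln 2) ln (1 + D / L)], where [D] is the distance
    from [c] to the open facilities, capped at [2 X + L].  An arrival at distance
    [r] from [c] with [2 r + L <= D] costs at most [2 f] times its opening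
    probability, and opening there lowers the potential by [2 f]; any other
    arrival costs at most [2 (3 r + L)].  Hence phase 2 costs at most the initial
    potential plus [O(G) + O(cost of Fhat)].

    If [m'] of the clients of the cluster are sampled, then [m' D <= X], so the
    initial value of [1 + D / L] is at most [4 (m + 1) / (m' + 1)], and enlarging
    the sample only helps.  Finally [E[(m + 1) / (m' + 1)] <= 1 / p] for
    [m' ~ Bin(m, p)], so by concavity of [ln] the expected initial potential is
    [O(f ln (4 / p))] per facility of [G]. *)

(** * Moments of an independent sample *)

Section SampleMoments.
Variables (R : realType) (n : nat) (p : R).
Implicit Types S C : {set 'I_n}.

Definition sample_weight S : R := p ^+ #|S| * (1 - p) ^+ (n - #|S|).

Lemma sample_weight_prod S :
  sample_weight S = \prod_i (if i \in S then p else 1 - p).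
Proof.
rewrite (bigID (fun i => i \in S)) /=.
rewrite (eq_bigr (fun=> p)); last by move=> i ->.
rewrite [X in _ = _ * X](eq_bigr (fun=> 1 - p)); last by move=> i /negbTE ->.
rewrite !prodr_const; congr (_ * _ ^+ _).
by rewrite -[X in (X - _)%N]card_ord -(cardC (mem S)) addKn.
Qed.

Lemma sample_weight_ge0 S : 0 <= p <= 1 -> 0 <= sample_weight S.
Proof.
by move=> /andP[p0 p1]; rewrite mulr_ge0 ?exprn_ge0 ?subr_ge0.
Qed.

Lemma sum_sample_weight : \sum_S sample_weight S = 1.
Proof.
under eq_bigr do rewrite sample_weight_prod.
rewrite -bigA_distr big1 // => i _ /=.
by rewrite addrC subrK.
Qed.

(** By independence, an index of [C] contributes the factor [1 - p + p X] and any other index the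
    factor [1]. *)
Lemma sample_card_genfun C :
  \sum_S (sample_weight S)%:P * 'X^#|S :&: C| =
  ((1 - p)%:P + p%:P * 'X) ^+ #|C|.
Proof.
transitivity (\prod_(i : 'I_n) (p%:P * 'X^(i \in C) + (1 - p)%:P)).
  rewrite bigA_distr; apply: eq_bigr => S _.
  rewrite sample_weight_prod rmorph_prod /= -sum1_card.
  have -> : (\sum_(i in S :&: C) 1 = \sum_(i in 'I_n) (i \in S :&: C))%N.
    by rewrite big_mkcond; apply: eq_bigr => i _; case: (i \in _).
  rewrite -prodrXr -big_split /=; apply: eq_bigr => i _.
  by rewrite finset.in_setI; case: (i \in S) => //=; rewrite expr0 mulr1.
rewrite (bigID (fun i => i \in C)) /= [X in _ * X]big1 ?mulr1.
  rewrite (eq_bigr (fun=> (1 - p)%:P + p%:P * 'X)) ?prodr_const // => i ->.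
  by rewrite expr1 addrC.
by move=> i /negbTE ->; rewrite expr0 mulr1 -polyCD addrC subrK.
Qed.

Lemma sample_card_dist C (k : nat) :
  \sum_S sample_weight S * (#|S :&: C| == k)%:R =
  (1 - p) ^+ (#|C| - k) * p ^+ k *+ 'C(#|C|, k).
Proof.
transitivity ((\sum_S (sample_weight S)%:P * 'X^#|S :&: C|)`_k).
  by rewrite coef_sum; apply: eq_bigr => S _; rewrite coefCM coefXn eq_sym.
rewrite sample_card_genfun exprDn coef_sum.
under eq_bigr => i _.
  rewrite exprMn mulrA -!polyC_exp -polyCM coefMn coefCM coefXn.
  over.
case: (ltnP k #|C|.+1) => hk.
  rewrite (bigD1 (Ordinal hk)) //= eqxx mulr1 big1 ?addr0 // => i /eqP ik.
  by case: eqP => [kk|_]; [case: ik; apply: val_inj | rewrite mulr0 mul0rn].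
rewrite bin_small // mulr0n big1 // => i _.
by rewrite gtn_eqF ?mulr0 ?mul0rn // (leq_trans (ltn_ord i)).
Qed.

(** Since [(m + 1) C(m, k) = (k + 1) C(m + 1, k + 1)], the sum is the binomial expansion of
    [(1 - p + p)^(m + 1)] without the term [(1 - p)^(m + 1)]. *)
Lemma expected_inv_sample_card C : 0 <= p <= 1 ->
  \sum_S sample_weight S * (p * #|C|.+1%:R / #|S :&: C|.+1%:R) <= 1.
Proof.
move=> /andP[p0 p1]; have q0 : 0 <= 1 - p by rewrite subr_ge0.
set m := #|C|.
have -> : \sum_S sample_weight S * (p * m.+1%:R / #|S :&: C|.+1%:R) =
    \sum_(k < m.+1) (1 - p) ^+ (m - k) * p ^+ k.+1 *+ 'C(m.+1, k.+1).
  transitivity (\sum_S \sum_(k < m.+1)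
      sample_weight S * (#|S :&: C| == k)%:R * (p * m.+1%:R / k.+1%:R)).
    apply: eq_bigr => S _.
    have hk : (#|S :&: C| < m.+1)%N by rewrite ltnS subset_leq_card ?subsetIr.
    rewrite (bigD1 (Ordinal hk)) //= eqxx mulr1 big1 ?addr0 // => i /eqP ik.
    by case: eqP => [kk|_]; [case: ik; apply: val_inj | rewrite mulr0 mul0r].
  rewrite exchange_big /=; apply: eq_bigr => k _.
  rewrite -mulr_suml sample_card_dist exprS -/m.
  have := mul_bin_diag m.+1 k => /(congr1 (fun x => x%:R : R)).
  rewrite /= !natrM => e.
  have k0 : (k.+1%:R : R) != 0 by rewrite pnatr_eq0.
  rewrite -[_ *+ 'C(m, k)]mulr_natr -[_ *+ 'C(m.+1, _)]mulr_natr.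
  apply: (mulIf k0); rewrite -!mulrA mulVf // mulr1.
  rewrite [_ * k.+1%:R]mulrC -e; ring.
rewrite -[leRHS](expr1n _ m.+1) -[X in _ <= X ^+ _](subrK p) exprDn.
by rewrite [leRHS]big_ord_recl lerDr mulrn_wge0 ?mulr_ge0 ?exprn_ge0.
Qed.
End SampleMoments.

(** * Distance to a list of facilities *)

Section Distance.
Variables (R : realType) (T : Type) (d : T -> T -> R).
Implicit Types (x y c : T) (F : seq T).

Lemma dist_cons x y c F :
  dist d x (y :: c :: F) = Num.min (d y x) (dist d x (c :: F)).
Proof.
rewrite /=; elim: F => [|e F IH] /=; first by rewrite minC.
by rewrite minCA IH minCA.
Qed.

Lemma dist_argmin x F : (0 < size F)%N ->
  exists j : 'I_(size F), dist d x F = d (tnth (in_tuple F) j) x.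
Proof.
elim: F => // y [_ _|c F IH _]; first by exists ord0.
rewrite dist_cons; case: (leP (d y x)) => _; first by exists ord0.
have [//|j ->] := IH; exists (lift ord0 j).
by rewrite !(tnth_nth y).
Qed.

Lemma dist_le x F (j : 'I_(size F)) :
  dist d x F <= d (tnth (in_tuple F) j) x.
Proof.
have z : T by exact: x.
rewrite (tnth_nth z) /=; case: j => j /=.
elim: F j => // y [|c F] IH [|j] // hj; rewrite ?dist_cons ge_min ?lexx //.
by rewrite IH ?orbT.
Qed.

Hypothesis dm : is_metric d.

Lemma metric_ge0 x y : 0 <= d x y. Proof. by case: dm => + _; apply. Qed.
Lemma metric_sym x y : d x y = d y x. Proof. by case: dm => _ [_ [+ _]]; apply. Qed.
Lemma metric_triangle x y z : d x z <= d x y + d y z.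
Proof. by case: dm => _ [_ [_ +]]; apply. Qed.

Lemma dist_ge0 x F : 0 <= dist d x F.
Proof.
case: F => // c F.
by have [//|j ->] := @dist_argmin x (c :: F); apply: metric_ge0.
Qed.

Lemma dist_triangle x y F : dist d x F <= d x y + dist d y F.
Proof.
case: F => [|c F]; first by rewrite addr0 metric_ge0.
have [//|j ->] := @dist_argmin y (c :: F).
apply: le_trans (dist_le x j) _; rewrite addrC (metric_sym x).
exact: metric_triangle.
Qed.
End Distance.

(** * Logarithmic potential and the cost of phase 2 *)

Section Potential.
Variables (R : realType) (T : Type) (d : T -> T -> R) (f : R).
Hypotheses (dm : is_metric d) (f_gt0 : 0 < f).
Implicit Types (x c : T) (F : seq T) (L M : R).

(* An empty [F] is at distance [+oo], hence at capped distance [M]. *)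
Definition capped_dist M x F : R :=
  if F is [::] then M else Num.min (dist d x F) M.

(** The weight [2 / ln 2 * f] of the full potential is put back in [phase2_cost_le_potential]. *)
Definition potential L M c F : R := ln (1 + capped_dist M c F / L).

Lemma capped_dist_cons M x y F :
  capped_dist M x (y :: F) = Num.min (d y x) (capped_dist M x F).
Proof. by case: F => // c F; rewrite /capped_dist dist_cons minA. Qed.

Lemma capped_dist_ge0 M x F : 0 <= M -> 0 <= capped_dist M x F.
Proof. by case: F => // c F M0; rewrite le_min M0 (dist_ge0 dm). Qed.

Lemma potential_ge0 L M c F : 0 < L -> 0 <= M -> 0 <= potential L M c F.
Proof.
move=> L0 M0; apply: ln_ge0; rewrite lerDl divr_ge0 ?(ltW L0) //.
exact: capped_dist_ge0.
Qed.

Lemma le_potential L M c F a : 0 < L -> 0 <= M ->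
  1 + capped_dist M c F / L <= a -> potential L M c F <= ln a.
Proof.
move=> L0 M0 ha.
have h : 0 < 1 + capped_dist M c F / L.
  by rewrite ltr_wpDr // divr_ge0 ?(ltW L0) // capped_dist_ge0.
by rewrite ler_ln // posrE // (lt_le_trans h).
Qed.

Lemma potential_cons L M c x F : 0 < L -> 0 <= M ->
  potential L M c (x :: F) <= potential L M c F.
Proof.
move=> L0 M0; apply: le_potential => //.
rewrite lerD2l ler_pM2r ?invr_gt0 // capped_dist_cons.
by rewrite ge_min lexx orbT.
Qed.

(* Either [x] lies so close to [c] that opening at [x] at least halves
   [L + capped_dist], or [x] is already well served by [F]. *)
Lemma potential_drop L M c x F : 0 < L -> 2 * d x c + L <= M ->
  potential L M c (x :: F) <= potential L M c F - ln 2 \/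
  (0 < size F)%N /\ dist d x F <= 3 * d x c + L.
Proof.
move=> L0 hM; have r0 := metric_ge0 dm x c; set D := capped_dist M c F.
have M0 : 0 <= M by lra.
have D0 : 0 <= D by exact: capped_dist_ge0.
have [hD|hD] := lerP (2 * d x c + L) D; [left|right].
  rewrite /potential -ln_div ?posrE //; last first.
    by rewrite ltr_wpDr // divr_ge0 ?(ltW L0).
  apply: le_potential => //; rewrite -/D capped_dist_cons -/D.
  have : Num.min (d x c) D <= d x c by rewrite ge_min lexx.
  move: (Num.min _ _) => D' hD'.
  (* The threshold [2 r + L <= D] says exactly that [r <= (D - L) / 2], the distance at which
     [1 + D / L] is halved. *)
  have -> : (1 + D / L) / 2 = 1 + (D - L) / 2 / L by field; rewrite gt_eqF.
  rewrite lerD2l ler_pM2r ?invr_gt0 //; lra.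
(* An empty [F] has capped distance [M], which [hM] puts at or above the threshold. *)
case: F @D D0 hD => [|y F] D D0 hD.
  by move: hM; rewrite leNgt hD.
split=> //; have := dist_triangle dm x c (y :: F).
move: hD; rewrite /D gt_min => /orP[|]; rewrite /dist; lra.
Qed.

Lemma open_prob_itv x F : 0 <= open_prob d f x F <= 1.
Proof.
case: F => [|c F]; first by rewrite /= ler01 lexx.
by rewrite /open_prob ge_min lexx orbT le_min ler01 divr_ge0 ?(dist_ge0 dm) ?ltW.
Qed.

Lemma open_prob_le_dist x F : (0 < size F)%N ->
  open_prob d f x F * f <= dist d x F.
Proof.
case: F => // c F _; rewrite -ler_pdivlMr // /open_prob.
by rewrite ge_min lexx.
Qed.

(** If [q < 1], then [q f] equals the distance, which bounds the expected connection cost; if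
    [q = 1], no connection is paid. *)
Lemma arrival_cost x F : let q := open_prob d f x F in
  q * f + (1 - q) * dist d x F <= 2 * (q * f).
Proof.
case: F => [|c F] /=; first by move: f_gt0; lra.
rewrite -[foldr _ _ _]/(dist d x (c :: F)).
have D0 := dist_ge0 dm x (c :: F); move: (dist _ _ _) D0 => D D0.
case: (leP (D / f) 1) => h; last by move: f_gt0; lra.
rewrite divfK ?gt_eqF //.
have : 0 <= D / f * D by rewrite mulr_ge0 // divr_ge0 // ltW.
lra.
Qed.

Lemma phase2_cost_le_potential (I : Type) (J : finType) (v : I -> T)
    (cl : I -> J) (c : J -> T) (L M : J -> R) :
  (forall j, 0 < L j) -> (forall j, 0 <= M j) ->
  (forall i, 2 * d (v i) (c (cl i)) + L (cl i) <= M (cl i)) ->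
  forall (xs : seq I) F,
  phase2_cost d f F (map v xs) <=
    2 / ln 2 * f * (\sum_j potential (L j) (M j) (c j) F) +
    \sum_(i <- xs) (6 * d (v i) (c (cl i)) + 2 * L (cl i)).
Proof.
move=> L0 M0 hM xs; have ln2 : 0 < ln 2 :> R by rewrite ln_gt0 // ltr1n.
have K0 : 0 <= 2 / ln 2 * f by rewrite !mulr_ge0 ?invr_ge0 ?ltW.
elim: xs => [|i xs IH] F.
  rewrite big_nil addr0 mulr_ge0 // sumr_ge0 // => j _.
  exact: potential_ge0.
rewrite [phase2_cost _ _ _ _]/= big_cons.
set x := v i; set q := open_prob _ _ _ _.
have IHo := IH (x :: F); have IHn := IH F.
set E := \sum_(_ <- xs) _ in IHo IHn *.
set Po := \sum_j _ in IHo; set Pn := \sum_j _ in IHn *.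
have /andP[q0 q1] : 0 <= q <= 1 := open_prob_itv x F.
have hc : q * f + (1 - q) * dist d x F <= 2 * (q * f) := arrival_cost x F.
have hP : Po <= Pn by apply: ler_sum => j _; exact: potential_cons.
have r0 := metric_ge0 dm x (c (cl i)).
have Li := L0 (cl i).
have h1 : q * phase2_cost d f (x :: F) (map v xs) <=
    q * (2 / ln 2 * f * Po + E) by rewrite ler_wpM2l.
have h2 : (1 - q) * phase2_cost d f F (map v xs) <=
    (1 - q) * (2 / ln 2 * f * Pn + E) by rewrite ler_wpM2l ?subr_ge0.
(* A drop by [ln 2], weighted by [2 / ln 2 * f], is worth [2 f]; occurring with probability [q], it
   pays [2 q f]. Otherwise [q f <= 3 r + L]. *)
have key : 2 * (q * f) + q * (2 / ln 2 * f * Po) <=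
    q * (2 / ln 2 * f * Pn) + (6 * d x (c (cl i)) + 2 * L (cl i)).
  case: (potential_drop F (L0 (cl i)) (hM i)) => [drop|[F0 hd]].
    have hP2 : Po <= Pn - ln 2.
      rewrite /Po /Pn (bigD1 (cl i)) //= [X in _ <= X - _](bigD1 (cl i)) //=.
      rewrite addrAC lerD // ler_sum // => j _; exact: potential_cons.
    have : 2 / ln 2 * f * Po <= 2 / ln 2 * f * (Pn - ln 2) by rewrite ler_wpM2l.
    have -> : 2 / ln 2 * f * (Pn - ln 2) = 2 / ln 2 * f * Pn - 2 * f.
      by field; rewrite gt_eqF.
    move=> /(ler_wpM2l q0); lra.
  have : q * f <= dist d x F by exact: open_prob_le_dist.
  have : q * (2 / ln 2 * f * Po) <= q * (2 / ln 2 * f * Pn).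
    by rewrite !ler_wpM2l.
  rewrite -/x in hd; lra.
lra.
Qed.
End Potential.

(** * Comparison with a fixed solution *)

Section Competitive.
Variables (R : realType) (T : Type) (d : T -> T -> R) (f : R).
Hypotheses (dm : is_metric d) (f_gt0 : 0 < f).

Lemma fl_cost_ge0 (F W : seq T) : 0 <= fl_cost d f F W.
Proof.
rewrite addr_ge0 ?mulr_ge0 ?(ltW f_gt0) // sumr_ge0 // => x _.
exact: dist_ge0.
Qed.

Lemma OPT_le (F W : seq T) : feasible F W -> OPT d f W <= fl_cost d f F W.
Proof.
move=> FW; apply: ge_inf; last by exists F.
by exists 0 => _ [G [_ ->]]; apply: fl_cost_ge0.
Qed.

(** The tangent of [ln] at [t] stands in for Jensen's inequality: the bound is made linear before
    expectations are taken. *)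
Lemma ln_le_tangent (y t : R) : 0 < y -> 0 < t -> ln y <= ln t + (y / t - 1).
Proof.
move=> y0 t0; rewrite -lerBlDl -ln_div ?posrE //.
have yt : 0 < y / t by rewrite divr_gt0.
have -> : y / t = 1 + (y / t - 1) by rewrite addrC subrK.
by rewrite [leRHS]addrAC subrr add0r le_ln1Dx //; lra.
Qed.

(** * Scale, cap and initial potential of one cluster *)

Section Cluster.
Variables (I : finType) (v : I -> T).
Implicit Types (c : T) (C S : {set I}) (F : seq T).

Definition cluster_mass c C S F : R :=
  f + \sum_(i in C) d (v i) c + \sum_(i in S :&: C) dist d (v i) F.

Definition cluster_scale c C S F : R := cluster_mass c C S F / #|C|.+1%:R.

(** As [r_i <= X] in the cluster, this cap meets the condition [2 r_i + L <= M] of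
    [potential_drop]. *)
Definition cluster_cap c C S F : R :=
  2 * cluster_mass c C S F + cluster_scale c C S F.

Lemma cluster_mass_gt0 c C S F : 0 < cluster_mass c C S F.
Proof.
apply: ltr_wpDr; first by apply: sumr_ge0 => i _; apply: dist_ge0.
by apply: ltr_wpDr => //; apply: sumr_ge0 => i _; apply: metric_ge0.
Qed.

Lemma cluster_scale_gt0 c C S F : 0 < cluster_scale c C S F.
Proof. by rewrite divr_gt0 // cluster_mass_gt0. Qed.

(** The distance from [c] to [F] is bounded through each sampled client of the cluster, and these
    triangle inequalities are summed. *)
Lemma sampled_dist_le_mass c C S F :
  #|S :&: C|%:R * dist d c F <= cluster_mass c C S F.
Proof.
rewrite mulr_natl -sumr_const.
apply: (@le_trans _ _ (\sum_(i in S :&: C) (d (v i) c + dist d (v i) F))).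
  apply: ler_sum => i _; rewrite (metric_sym dm); exact: dist_triangle.
rewrite big_split /= lerD2r ler_wpDl ?(ltW f_gt0) //.
rewrite [leRHS](big_setID S) /= finset.setIC lerDl sumr_ge0 // => i _.
exact: metric_ge0.
Qed.

Lemma initial_capped_dist c C S S' F :
    S' \subset S -> (#|S :&: C| != 0 -> 0 < size F)%N ->
  1 + capped_dist d (cluster_cap c C S F) c F / cluster_scale c C S F <=
  4 * (#|C|.+1%:R / #|S' :&: C|.+1%:R).
Proof.
move=> SS hF; rewrite /cluster_cap /cluster_scale.
have := sampled_dist_le_mass c C S F; have := cluster_mass_gt0 c C S F.
move: (cluster_mass _ _ _ _) => X X0 hX.
have hm : (#|S :&: C| <= #|C|)%N by rewrite subset_leq_card ?subsetIr.
have hm' : (#|S' :&: C| <= #|S :&: C|)%N by rewrite subset_leq_card ?finset.setSI.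
apply: (@le_trans _ _ (4 * (#|C|.+1%:R / #|S :&: C|.+1%:R))); last first.
  by rewrite ler_pM2l // ler_pM2l // lef_pV2 ?posrE // ler_nat.
move: hF hX hm {hm'} => + + hm.
have : 1 <= #|C|.+1%:R :> R by rewrite ler1n.
have : #|S :&: C|.+1%:R <= #|C|.+1%:R :> R by rewrite ler_nat.
rewrite -[#|S :&: C|.+1%:R]natr1.
move: #|S :&: C| #|C|.+1%:R hm => m a _ ma a1 hF hX.
have a0 : 0 < a by lra.
have L0 : 0 < X / a by rewrite divr_gt0.
(* Without sampled clients only the cap helps: [X = a L] gives [1 + D / L <= 2 a + 2 <= 4 a]. *)
have [m0|m0] := eqVneq m 0%N.
  have D : capped_dist d (2 * X + X / a) c F <= 2 * X + X / a.
    by case: (F) => // y G; rewrite ge_min lexx orbT.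
  have -> : 4 * (a / (m%:R + 1)) = 1 + (4 * a - 1) * (X / a) / (X / a).
    rewrite m0; field; rewrite !gt_eqF //.
  rewrite lerD2l ler_pM2r ?invr_gt0 //; apply: le_trans D _.
  have -> : 2 * X = 2 * a * (X / a) by field; rewrite gt_eqF.
  by rewrite -{2}[X / a]mul1r -mulrDl ler_pM2r //; lra.
(* Now [D / L <= a / m]; with [m + a <= 2 a] and [m + 1 <= 2 m] this gives
   [1 + a / m <= 4 a / (m + 1)]. *)
have m1 : 1 <= m%:R :> R by rewrite ler1n lt0n.
have D : m%:R * capped_dist d (2 * X + X / a) c F <= X.
  apply: le_trans hX; rewrite ler_wpM2l //.
  by case: (F) (hF m0) => // y G _; rewrite ge_min lexx.
move: (capped_dist _ _ _ _) D => D hD.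
have mgt0 : 0 < m%:R :> R by lra.
have {}hD : D / (X / a) <= a / m%:R.
  rewrite ler_pdivrMr // (_ : a / m%:R * (X / a) = X / m%:R); last first.
    by field; rewrite !gt_eqF.
  by rewrite ler_pdivlMr // mulrC.
apply: (@le_trans _ _ (1 + a / m%:R)); first by rewrite lerD2l.
rewrite mulrA ler_pdivlMr; last by lra.
have -> : (1 + a / m%:R) * (m%:R + 1) = (m%:R + a) * (m%:R + 1) / m%:R.
  by field; rewrite gt_eqF.
rewrite ler_pdivrMr //; nra.
Qed.
End Cluster.

(** * Cost for a fixed sample, then in expectation *)

Variables (A : seq T -> seq T) (gamma : R).
Hypotheses (gamma_ge0 : 0 <= gamma) (apxA : approx_alg d f gamma A).

(** The logarithms involve only the independent sample [S'], not its augmentation [S], so that they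
    can be averaged later. *)
Lemma alg_cost_le (n : nat) (v : 'I_n -> T) (G : seq T)
    (cl : 'I_n -> 'I_(size G)) (S S' : {set 'I_n}) (s : seq 'I_n) :
    (forall i, dist d (v i) G = d (tnth (in_tuple G) (cl i)) (v i)) ->
    feasible G [seq v i | i <- enum 'I_n] ->
    S' \subset S -> perm_eq s (enum (~: S)) ->
  alg_cost d f A [seq v i | i <- enum S] [seq v i | i <- s] <=
  (3 * gamma + 8) * fl_cost d f G [seq v i | i <- enum 'I_n] +
  2 / ln 2 * f * \sum_(j < size G)
    ln (4 * (#|cl @^-1: [set j]|.+1%:R / #|S' :&: cl @^-1: [set j]|.+1%:R)).
Proof.
move=> hcl hG SS sS; have f0 := ltW f_gt0.
set c := tnth (in_tuple G) in hcl.
set Cl := fun j => cl @^-1: [set j].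
have inCl i j : (i \in Cl j) = (cl i == j) by rewrite !inE.
set V := [seq v i | i <- enum 'I_n].
set W := [seq v i | i <- enum S].
have [fW cW] := apxA W; set F := A W in fW cW *.
have hr i : dist d (v i) G = d (v i) (c (cl i)) by rewrite hcl (metric_sym dm).
set r := fun i => d (v i) (c (cl i)).
have r0 i : 0 <= r i by exact: metric_ge0.
have costV : fl_cost d f G V = f * (size G)%:R + \sum_i r i.
  by rewrite /fl_cost big_map big_enum; congr (_ + _); apply: eq_bigr.
(* [G] also serves the sampled clients. *)
have WV : OPT d f W <= fl_cost d f G V.
  apply: le_trans (OPT_le (F := G) _) _.
    move: hG; rewrite /feasible !size_map -enumT size_enum_ord -cardE.
    case/orP=> [/eqP n0|->]; last by rewrite orbT.
    by rewrite -leqn0 (leq_trans (max_card _)) // card_ord n0.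
  rewrite /fl_cost lerD2l !big_map !big_enum /= big_mkcond ler_sum // => i _.
  by case: ifP => // _; apply: dist_ge0.
have {}cW : fl_cost d f F W <= gamma * fl_cost d f G V.
  by apply: le_trans cW _; rewrite ler_wpM2l.
have costW : fl_cost d f F W = f * (size F)%:R + \sum_(i in S) dist d (v i) F.
  by rewrite /fl_cost big_map big_enum.
set X := fun j => cluster_mass v (c j) (Cl j) S F.
set L := fun j => cluster_scale v (c j) (Cl j) S F.
set M := fun j => cluster_cap v (c j) (Cl j) S F.
have L0 j : 0 < L j by exact: cluster_scale_gt0.
have X0 j : 0 < X j by exact: cluster_mass_gt0.
have M0 j : 0 <= M j.
  apply: addr_ge0; last exact: ltW (L0 j).
  by apply: mulr_ge0 => //; exact: ltW (X0 j).
have rX i : r i <= X (cl i).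
  rewrite /X /cluster_mass (bigD1 i) ?inCl //= -/(r i).
  rewrite -!addrA addrCA lerDl; apply: addr_ge0 => //; apply: addr_ge0.
    by apply: sumr_ge0 => k _; apply: metric_ge0.
  by apply: sumr_ge0 => k _; apply: dist_ge0.
have sumX : \sum_j X j =
    f * (size G)%:R + \sum_i r i + \sum_(i in S) dist d (v i) F.
  rewrite !big_split /= sumr_const card_ord mulr_natr; congr (_ + _ + _).
    rewrite [RHS](partition_big cl predT) //=; apply: eq_bigr => j _.
    by apply: eq_big => [i|i]; rewrite inCl // => /eqP <-.
  rewrite [RHS](partition_big cl predT) //=; apply: eq_bigr => j _.
  by apply: eq_bigl => i; rewrite finset.in_setI inCl.
(* Each of the [m] clients of a cluster is charged [X / (m + 1)], in total less than [X]. *)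
have sumL : \sum_i L (cl i) <= \sum_j X j.
  rewrite (partition_big cl predT) //=; apply: ler_sum => j _.
  rewrite (eq_bigr (fun=> L j)) => [|i /eqP -> //].
  rewrite sumr_const -mulr_natr /L /cluster_scale -/(X j).
  have -> : #|[pred i | cl i == j]| = #|Cl j|.
    by apply: eq_card => i; rewrite inCl.
  by rewrite mulrAC ler_pdivrMr // ler_pM2l // ler_nat.
have hM i : 2 * d (v i) (c (cl i)) + L (cl i) <= M (cl i).
  by rewrite lerD2r ler_pM2l // rX.
have hpot : \sum_j potential d (L j) (M j) (c j) F <= \sum_(j < size G)
    ln (4 * (#|Cl j|.+1%:R / #|S' :&: Cl j|.+1%:R)).
  apply: ler_sum => j _; apply: le_potential => //.
  (* A sampled client makes [W] nonempty, hence [F] nonempty by feasibility. *)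
  apply: initial_capped_dist => //; rewrite cards_eq0 => /set0Pn[i].
  rewrite finset.in_setI => /andP[iS _].
  move: fW; rewrite /feasible size_map -cardE cards_eq0.
  by case/orP=> // /eqP S0; rewrite S0 inE in iS.
have h2 := phase2_cost_le_potential dm f_gt0 L0 M0 hM s F.
have hs : \sum_(i <- s) (6 * r i + 2 * L (cl i)) <=
    6 * \sum_i r i + 2 * \sum_i L (cl i).
  rewrite (perm_big _ sS) /= big_enum /= !mulr_sumr -big_split /=.
  rewrite big_mkcond ler_sum // => i _; case: ifP => // _.
  by apply: addr_ge0; apply: mulr_ge0 => //; exact: ltW (L0 _).
have K0 : 0 <= 2 / ln 2 * f.
  by rewrite !mulr_ge0 ?invr_ge0 // ltW // ln_gt0 // ltr1n.
have := ler_wpM2l K0 hpot.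
rewrite /alg_cost -/F -/(Cl _); move: h2 hs.
move: (\sum_(i <- s) _) (phase2_cost _ _ _ _) => E P.
have := fl_cost_ge0 G V; have : 0 <= f * (size G)%:R by rewrite mulr_ge0.
have : 0 <= \sum_i r i by exact: sumr_ge0.
have : 0 <= f * (size F)%:R by rewrite mulr_ge0.
have : 0 <= \sum_(i in S) dist d (v i) F.
  by apply: sumr_ge0 => i _; apply: dist_ge0.
(* Besides the logarithms, [G] accounts for [2 f |G| + 8 sum r_i] and [F] for at most twice its cost
   on [W]. *)
move: cW costV costW sumX sumL.
lra.
Qed.

(** [alg_cost_le] holds for every outcome [S'], so [aug] and [ord] may depend on it. *)
Lemma exp_cost_le (p : R) (n : nat) (v : 'I_n -> T)
    (aug : {set 'I_n} -> {set 'I_n}) (ord : {set 'I_n} -> seq 'I_n)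
    (G : seq T) :
    0 < p <= 1 -> (forall S' : {set 'I_n}, S' \subset aug S') -> valid_order ord ->
    feasible G [seq v i | i <- enum 'I_n] ->
  exp_cost d f A p v aug ord <=
  (3 * gamma + 8 + 2 / ln 2 * ln (4 / p)) *
    fl_cost d f G [seq v i | i <- enum 'I_n].
Proof.
move=> /andP[p0 p1] augP ordP hG; set V := [seq v i | i <- enum 'I_n].
have p01 : 0 <= p <= 1 by rewrite (ltW p0).
have nearest i : exists j, dist d (v i) G = d (tnth (in_tuple G) j) (v i).
  apply: dist_argmin.
  move: hG; rewrite /feasible size_map size_enum_ord => /orP[/eqP n0|//].
  by move: (ltn_ord i); rewrite {2}n0.
have [cl hcl] := choice nearest.
set K : R := 2 / ln 2.
have K0 : 0 <= K by rewrite mulr_ge0 ?invr_ge0 // ltW // ln_gt0 // ltr1n.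
set B := (3 * gamma + 8) * fl_cost d f G V.
set e := fun j (S : {set 'I_n}) =>
  p * #|cl @^-1: [set j]|.+1%:R / #|S :&: cl @^-1: [set j]|.+1%:R.
have step S : alg_cost d f A [seq v i | i <- enum (aug S)]
      [seq v i | i <- ord (aug S)] <=
    B + K * f * \sum_(j < size G) (ln (4 / p) - 1 + e j S).
  apply: le_trans (alg_cost_le hcl hG (augP S) (ordP _)) _.
  rewrite lerD2l; apply: ler_wpM2l; first exact: mulr_ge0 (ltW f_gt0).
  apply: ler_sum => j _.
  rewrite /e; move: #|cl @^-1: _| #|_ :&: _| => a b.
  (* The tangent point [4 / p] turns the ratio into [e j S], whose expectation is at most [1] and
     offsets the [- 1]. *)
  apply: le_trans (ln_le_tangent (t := 4 / p) _ _) _.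
  - by rewrite mulr_gt0 // divr_gt0.
  - by rewrite divr_gt0.
  have -> : 4 * (a.+1%:R / b.+1%:R) / (4 / p) = p * a.+1%:R / b.+1%:R.
    have : b.+1%:R != 0 :> R by rewrite pnatr_eq0.
    by move: (a.+1%:R) (b.+1%:R) => x y y0; field; rewrite y0 gt_eqF.
  by rewrite addrA addrAC.
have := @sum_sample_weight R n p.
rewrite /exp_cost -/(sample_weight _ _) => sum1.
apply: (@le_trans _ _ (\sum_(S : {set 'I_n}) sample_weight p S *
    (B + K * f * \sum_(j < size G) (ln (4 / p) - 1 + e j S)))).
  by apply: ler_sum => S _; rewrite ler_wpM2l ?step // sample_weight_ge0.
have -> : \sum_(S : {set 'I_n}) sample_weight p S *
      (B + K * f * \sum_(j < size G) (ln (4 / p) - 1 + e j S)) =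
    B + K * f * \sum_(j < size G) (ln (4 / p) - 1 +
      \sum_(S : {set 'I_n}) sample_weight p S * e j S).
  clearbody B e; under eq_bigr do rewrite mulrDr mulrCA mulr_sumr.
  rewrite big_split /= -mulr_suml sum1 mul1r -mulr_sumr exchange_big /=.
  congr (_ + _ * _); apply: eq_bigr => j _.
  under eq_bigr do rewrite mulrDr.
  by rewrite big_split /= -mulr_suml sum1 mul1r.
have le_ln : \sum_(j < size G) (ln (4 / p) - 1 +
    \sum_(S : {set 'I_n}) sample_weight p S * e j S) <=
    (size G)%:R * ln (4 / p).
  have -> : (size G)%:R * ln (4 / p) = \sum_(j < size G) ln (4 / p).
    by rewrite sumr_const card_ord mulr_natl.
  apply: ler_sum => j _.
  by have := expected_inv_sample_card (cl @^-1: [set j]) p01; rewrite -/e; lra.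
rewrite [leRHS]mulrDl lerD2l.
apply: le_trans (ler_wpM2l _ le_ln) _; first by rewrite mulr_ge0 ?(ltW f_gt0).
have ln0 : 0 <= ln (4 / p) by apply: ln_ge0; rewrite ler_pdivlMr //; lra.
have -> : K * f * ((size G)%:R * ln (4 / p)) =
  K * ln (4 / p) * (f * (size G)%:R) by ring.
apply: ler_wpM2l; first exact: mulr_ge0.
by rewrite lerDl sumr_ge0 // => x _; apply: dist_ge0.
Qed.
End Competitive.

(** * Competitive ratio against the offline optimum *)

Theorem theoremA3 (R : realType) (gamma : R) (hgamma : 1 <= gamma) :
  exists C : R, 0 < C /\
    forall (T : Type) (d : T -> T -> R) (f : R) (A : seq T -> seq T) (p : R),
      is_metric d -> 0 < f -> approx_alg d f gamma A -> 0 < p <= 1 ->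
      competitive d f A p (C * (1 + ln (p^-1))) /\
      monotone_competitive d f A p (C * (1 + ln (p^-1))).
Proof.
have ln2 : 0 < ln 2 :> R by rewrite ln_gt0 // ltr1n.
have ln4 : 0 < ln 4 :> R by rewrite ln_gt0 // ltr1n.
have K0 : 0 < 2 / ln 2 :> R by rewrite divr_gt0.
have K4 : 0 < 2 / ln 2 * ln 4 :> R by rewrite mulr_gt0.
(* As [ln (4 / p) = ln 4 + ln (1 / p)], the summand [ln 4] covers the constant part and [1] the
   coefficient of [ln (1 / p)]. *)
exists (3 * gamma + 8 + 2 / ln 2 * (ln 4 + 1)); split; first by lra.
move=> T d f A p dm f0 apxA p01; have /andP[p0 p1] := p01.
set C := _ + _ * _; set alpha := C * _.
suff mono : monotone_competitive d f A p alpha.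
  by split=> // n v ord; apply: mono => S; apply: subxx.
have l0 : 0 <= ln p^-1 by rewrite ln_ge0 // invf_ge1.
have alpha_ge : 3 * gamma + 8 + 2 / ln 2 * ln (4 / p) <= alpha.
  have -> : ln (4 / p) = ln 4 + ln p^-1 by rewrite lnM ?posrE ?invr_gt0.
  rewrite /alpha /C.
  have : 0 <= (3 * gamma + 8 + 2 / ln 2 * ln 4) * ln p^-1.
    by rewrite mulr_ge0 //; lra.
  lra.
have alpha0 : 0 < alpha by rewrite mulr_gt0 // /C; lra.
move=> n v aug ord augP ordP; rewrite mulrC -ler_pdivrMr //.
(* [OPT] is an infimum, so the bound is shown for every feasible [G]; opening a facility at each
   client shows that feasible solutions exist. *)
apply: lb_le_inf.
  set V := map _ _; exists (fl_cost d f V V), V; split => //.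
  by rewrite /feasible; case: (size V).
move=> _ [G [hG ->]]; rewrite ler_pdivrMr //.
have gamma0 : 0 <= gamma by lra.
apply: le_trans (exp_cost_le dm f0 gamma0 apxA p01 augP ordP hG) _.
by rewrite mulrC ler_wpM2l // fl_cost_ge0.
Qed.
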